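(* Let $f:[a,b]\times\mathbb{R}\to\mathbb{R}$ be of class $C^\infty$, let $u\in C^\infty[a,b]$ be a solution of $u'(t)=f(t,u(t))$, fix $t_i\in[a,b)$ and write $u_i=u(t_i)$, $u_i''=u''(t_i)=f_t+f_uf$; all derivatives of $f$ below are evaluated at $(t_i,u_i)$. Consider the three-stage MQ-RBF-based RK3 method. In each of the following cases the method is fourth-order accurate, i.e. its local truncation error satisfies $\tau_i=\mathcal{O}(h^4)$ as $h\to0^+$ (in cases B2, B3, B4 the denominator in the formula for $\varepsilon_{2i}^2$ is assumed nonzero). B1: $a_{21}=c_2=\frac12$, $a_{31}=-1$, $a_{32}=2$, $c_3=1$, $w_1=\frac16$, $w_2=\frac23$, $w_3=\frac16$, with $$\varepsilon_{2i}^2=\frac{(f_{uu}f-f_u^2+f_{tu})u_i''}{(f_{uu}f-f_u^2+f_{tu})u_i+f_uf},\qquad \varepsilon_{3i}^2=-\varepsilon_{2i}^2,$$ provided that $(f_{uu}f-f_u^2+f_{tu})u_i+f_uf\neq0$ whenever $(f_{uu}f-f_u^2+f_{tu})(f_t+f_uf)\neq0$ (if numerator and denominator both vanish, $\varepsilon_{2i}^2$ may be any real number). If this proviso fails, then with $\varepsilon_{3i}^2=-\varepsilon_{2i}^2$ the method is only third-order accurate. B2(a): $a_{21}=c_2=\frac58+\frac{\sqrt{33}}{24}$, $a_{31}=-\frac{49}{256}+\frac{29\sqrt{33}}{768}$, $a_{32}=\frac{209}{256}-\frac{61\sqrt{33}}{768}$, $c_3=\frac58-\frac{\sqrt{33}}{24}$,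 $w_1=\frac18$, $w_2=\frac7{16}-\frac{3\sqrt{33}}{176}$, $w_3=\frac7{16}+\frac{3\sqrt{33}}{176}$, with $$\varepsilon_{2i}^2=\frac{12f_u^2u_i''+(3+\sqrt{33})(f^2f_{uu}-f_{tt})f_u+2(3+\sqrt{33})(f_{uu}f+f_{tu})f_t}{\left[2(3+\sqrt{33})(ff_{uu}+f_{tu})+(15+\sqrt{33})f_u^2\right]u_i+2(3+\sqrt{33})f_uf},\qquad \varepsilon_{3i}^2=\frac{-7-\sqrt{33}}{4}\varepsilon_{2i}^2.$$ B2(b): $a_{21}=c_2=\frac58-\frac{\sqrt{33}}{24}$, $a_{31}=-\frac{49}{256}-\frac{29\sqrt{33}}{768}$, $a_{32}=\frac{209}{256}+\frac{61\sqrt{33}}{768}$, $c_3=\frac58+\frac{\sqrt{33}}{24}$, $w_1=\frac18$, $w_2=\frac7{16}+\frac{3\sqrt{33}}{176}$, $w_3=\frac7{16}-\frac{3\sqrt{33}}{176}$, with $$\varepsilon_{2i}^2=\frac{12f_u^2u_i''+(3-\sqrt{33})(f_{uu}f^2-f_{tt})f_u+2(3-\sqrt{33})(f_{uu}f+f_{tu})f_t}{\left[2(3-\sqrt{33})(ff_{uu}+f_{tu})+(15-\sqrt{33})f_u^2\right]u_i+2(3-\sqrt{33})f_uf},\qquad \varepsilon_{3i}^2=\frac{-7+\sqrt{33}}{4}\varepsilon_{2i}^2.$$ B3(a): $a_{21}=c_2=1$, $a_{31}=\frac14$, $a_{32}=\frac14$, $c_3=\frac12$, $w_1=\frac16$,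 $w_2=\frac16$, $w_3=\frac23$, with $$\varepsilon_{2i}^2=\frac{f_u^2u_i''-(f_{tu}f+f_{tt})f_u+(f_{uu}f+f_{tu})f_t}{\left[f_{uu}f+f_{tu}+2f_u^2\right]u_i+f_uf},\qquad \varepsilon_{3i}^2=-\varepsilon_{2i}^2.$$ B3(b): $a_{21}=c_2=\frac13$, $a_{31}=-\frac5{12}$, $a_{32}=\frac54$, $c_3=\frac56$, $w_1=\frac1{10}$, $w_2=\frac12$, $w_3=\frac25$, with $$\varepsilon_{2i}^2=\frac{3f_u^2u_i''+(f_{tu}f+f_{tt})f_u-(f_{uu}f+f_{tu})f_t}{\left[-f_{uu}f-f_{tu}+2f_u^2\right]u_i-f_uf},\qquad \varepsilon_{3i}^2=-\tfrac15\varepsilon_{2i}^2.$$ B4: $a_{21}=c_2=\frac12$, $a_{31}=0$, $a_{32}=\frac34$, $c_3=\frac34$, $w_1=\frac29$, $w_2=\frac13$, $w_3=\frac49$, with $$\varepsilon_{2i}^2=\frac{12f_u^2u_i''+f_{ttt}+f_{uuu}f^3+3(f_{ttu}+f_{tuu}f)f}{3\left(-f_{uu}f-f_{tu}+4f_u^2\right)u_i-3f_uf},\qquad \varepsilon_{3i}^2=-\tfrac13\varepsilon_{2i}^2.$$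
   Context: The MQ-RBF-based RK3 method with step size $h>0$ for $u'=f(t,u)$ takes $\mathbf{u}_i$ to $\mathbf{u}_{i+1}=\mathbf{u}_i+h[w_1K_1+w_2K_2+w_3K_3]$, where $$K_1=f(t_i,\mathbf{u}_i),\qquad K_2=f\Big(t_i+c_2h,\ \Big(1+\tfrac{\varepsilon_{2i}^2(c_2h)^2}{2}\Big)\big(\mathbf{u}_i+ha_{21}K_1\big)\Big),$$ $$K_3=f\Big(t_i+c_3h,\ \Big(1+\tfrac{\varepsilon_{3i}^2(c_3h)^2}{2}\Big)\big(\mathbf{u}_i+h(a_{31}K_1+a_{32}K_2)\big)\Big).$$ The quantities $\varepsilon_{2i}^2,\varepsilon_{3i}^2$ are treated as real parameters, which may be negative. The local truncation error at $t_i$ is $$\tau_i=\frac{u(t_i+h)-u(t_i)}{h}-(w_1K_1+w_2K_2+w_3K_3),$$ with the $K_j$ computed by the formulas above starting from the exact value $\mathbf{u}_i=u(t_i)$. Order $p$ means $\tau_i=\mathcal{O}(h^p)$ as $h\to0^+$, where $t_i$ and the values $\varepsilon_{2i}^2,\varepsilon_{3i}^2$ are held fixed; ''only third-order'' means $\tau_i=\mathcal{O}(h^3)$ but $\tau_i\neq\mathcal{O}(h^4)$ for every real value of $\varepsilon_{2i}^2$. *)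

(* Defs.v *)
From Stdlib Require Import Reals.
From Coquelicot Require Import Coquelicot.
Open Scope R_scope.

Definition Icc (a b t : R) : Prop := a <= t <= b.

(* Derivative relative to a set D; at an endpoint of D = [a,b] this is the
   one-sided derivative, so values of g outside D play no role. *)
Definition is_derive_on (D : R -> Prop) (g : R -> R) (x l : R) : Prop :=
  filterdiff g (within D (locally x)) (fun y : R => scal y l).

Definition ex_derive_on (D : R -> Prop) (g : R -> R) (x : R) : Prop :=
  exists l : R, is_derive_on D g x l.

(* The value is meaningful only where the derivative relative to D exists and
   x is not isolated in D. *)
Definition Derive_on (D : R -> Prop) (g : R -> R) (x : R) : R :=
  iota (fun l : R => is_derive_on D g x l).

Fixpoint Derive_n_on (D : R -> Prop) (n : nat) (g : R -> R) : R -> R :=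
  match n with
  | O => g
  | S m => Derive_on D (Derive_n_on D m g)
  end.

Definition smooth_on (D : R -> Prop) (g : R -> R) : Prop :=
  forall (n : nat) (x : R), D x -> ex_derive_on D (Derive_n_on D n g) x.

(* Functions on the strip [a,b] x R are total functions R -> R -> R of which
   only the values at first argument in [a,b] are used. *)
Definition strip (a b : R) (p : R * R) : Prop := Icc a b (fst p).

Definition Dt (a b : R) (g : R -> R -> R) (t u : R) : R :=
  Derive_on (Icc a b) (fun s => g s u) t.

Definition Du (g : R -> R -> R) (t u : R) : R := Derive (fun v => g t v) u.

Fixpoint Ck_strip (a b : R) (k : nat) (g : R -> R -> R) : Prop :=
  continuous_on (strip a b) (fun p : R * R => g (fst p) (snd p)) /\
  match k with
  | O => True
  | S m =>
      (forall t u : R, Icc a b t ->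
         ex_derive_on (Icc a b) (fun s => g s u) t /\
         ex_derive (fun v => g t v) u) /\
      Ck_strip a b m (Dt a b g) /\ Ck_strip a b m (Du g)
  end.

Definition smooth_strip (a b : R) (g : R -> R -> R) : Prop :=
  forall k : nat, Ck_strip a b k g.

Definition is_solution (a b : R) (f : R -> R -> R) (u : R -> R) : Prop :=
  forall t : R, Icc a b t -> is_derive_on (Icc a b) u t (f t (u t)).

Record rk3_coeffs : Set := {
  a21 : R; c2 : R; a31 : R; a32 : R; c3 : R; w1 : R; w2 : R; w3 : R
}.

(* e2 and e3 stand for the squared shape parameters eps_2^2 and eps_3^2; they
   are arbitrary reals, possibly negative. *)
Section Method.
Variables (f : R -> R -> R) (c : rk3_coeffs) (e2 e3 t v h : R).

Definition stage1 : R := f t v.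

Definition stage2 : R :=
  f (t + c2 c * h)
    ((1 + e2 * (c2 c * h) ^ 2 / 2) * (v + h * (a21 c * stage1))).

Definition stage3 : R :=
  f (t + c3 c * h)
    ((1 + e3 * (c3 c * h) ^ 2 / 2)
     * (v + h * (a31 c * stage1 + a32 c * stage2))).

Definition increment : R :=
  w1 c * stage1 + w2 c * stage2 + w3 c * stage3.

Definition mq_rk3_step : R := v + h * increment.
End Method.

Definition truncation_error (f : R -> R -> R) (u : R -> R) (t : R)
    (c : rk3_coeffs) (e2 e3 h : R) : R :=
  (u (t + h) - u t) / h - increment f c e2 e3 t (u t) h.

(* g(h) = O(h^p) as h -> 0+ *)
Definition is_bigO_pow (g : R -> R) (p : nat) : Prop :=
  exists C : R, at_right 0 (fun h => Rabs (g h) <= C * h ^ p).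

Definition has_order (f : R -> R -> R) (u : R -> R) (t : R)
    (c : rk3_coeffs) (e2 e3 : R) (p : nat) : Prop :=
  is_bigO_pow (truncation_error f u t c e2 e3) p.

(* Main.v *)
Require Import Defs.
From Stdlib Require Import Reals Factorial Lra Lia.
From Coquelicot Require Import Coquelicot.
Open Scope R_scope.

(* Both sides of the truncation error are expanded modulo O(h^4).  As
   u' = f(t,u), comparing the expansions of u'(t+h) and f(t+h,u(t+h)) yields u'', u''',
   u'''' as polynomials in the derivatives of f; substituting the expansion of each
   stage argument into the Taylor expansion of f yields the expansions of K2 and
   K3.  The coefficients of 1, h and h^2 of the truncation error vanish because
   of the weights and the ratio of the two shape parameters, and the coefficient
   of h^3 is k (num - den e2), with e2 = num / den the stated formula and k a
   nonzero rational number.  For B1, k = -1/24, so if den = 0 and num <> 0 no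
   choice of e2 cancels this coefficient. *)

(** * Taylor expansion with one-sided derivatives *)

(** [filterdiff] speaks of every limit of the filter; since [x] lies in [D], [x] is one of them, and
    the little-o condition there is this epsilon-delta bound. *)
Lemma is_derive_on_bound (D : R -> Prop) (g : R -> R) (x l : R) :
  D x -> is_derive_on D g x l ->
  forall eps : posreal, exists delta : posreal, forall y, D y ->
    Rabs (y - x) < delta ->
    Rabs (g y - g x - (y - x) * l) <= eps * Rabs (y - x).
Proof.
  intros Dx [_ Hd] eps.
  assert (Hx : is_filter_lim (within D (locally x)) x).
  { intros P HP. now apply filter_le_within. }
  destruct (Hd x Hx eps) as [delta Hdelta].
  exists delta. intros y Dy Hy.
  exact (Hdelta y Hy Dy).
Qed.

Lemma is_derive_on_of_is_derive (D : R -> Prop) (g : R -> R) (x l : R) :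
  D x -> is_derive g x l -> is_derive_on D g x l.
Proof.
  intros Dx [Hl Hd]. split; [exact Hl|].
  intros z Hz.
  assert (Hle : filter_le (within D (locally x)) (locally x))
    by apply filter_le_within.
  (* Here [D x] matters: for [z] other than [x], the ball about [z] of radius [Rabs (x - z)] would
     have to contain [x]. *)
  assert (z = x) as ->.
  { destruct (Req_dec z x) as [E | Hne]; [lra|].
    assert (He : 0 < Rabs (x - z)) by (apply Rabs_pos_lt; lra).
    assert (Hb : locally z (ball z (mkposreal _ He))) by apply locally_ball.
    destruct (Hz _ Hb) as [d Hd'].
    specialize (Hd' x (ball_center x d) Dx).
    change (Rabs (x - z) < Rabs (x - z)) in Hd'. lra. }
  apply is_domin_le with (1 := Hd x (fun P HP => HP)). exact Hle.
Qed.

Lemma is_derive_on_minus (D : R -> Prop) (g1 g2 : R -> R) (x l1 l2 : R) :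
  is_derive_on D g1 x l1 -> is_derive_on D g2 x l2 ->
  is_derive_on D (fun y => g1 y - g2 y) x (l1 - l2).
Proof.
  intros H1 H2. unfold is_derive_on.
  apply filterdiff_ext_lin with
    (fun y : R => minus (scal y l1) (scal y l2)).
  - exact (filterdiff_minus_fct g1 g2 _ _ H1 H2).
  - intros y. unfold minus, plus, opp, scal; simpl; unfold mult; simpl. ring.
Qed.

(** As [a < b], no point of the segment is isolated. At a nearby point the two linear
    approximations, each with tolerance a quarter of [Rabs (l1 - l2)], contradict each other. *)
Lemma is_derive_on_unique (a b : R) (g : R -> R) (x l1 l2 : R) :
  a < b -> Icc a b x ->
  is_derive_on (Icc a b) g x l1 -> is_derive_on (Icc a b) g x l2 -> l1 = l2.
Proof.
  intros Hab Hx H1 H2.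
  destruct (Req_dec l1 l2) as [E | Hne]; [exact E|exfalso].
  assert (He : 0 < Rabs (l1 - l2) / 4)
    by (generalize (Rabs_pos_lt (l1 - l2)); lra).
  destruct (is_derive_on_bound _ _ _ _ Hx H1 (mkposreal _ He)) as [d1 B1].
  destruct (is_derive_on_bound _ _ _ _ Hx H2 (mkposreal _ He)) as [d2 B2].
  simpl in B1, B2.
  assert (Hy : exists y, Icc a b y /\ y <> x /\ Rabs (y - x) < Rmin d1 d2).
  { pose proof (Rmin_pos _ _ (cond_pos d1) (cond_pos d2)) as Hd.
    set (d := Rmin d1 d2) in *. unfold Icc in *.
    destruct (Rlt_dec x b) as [Hxb | Hxb].
    - exists (Rmin b (x + d / 2)).
      unfold Rmin; destruct Rle_dec; rewrite Rabs_right; lra.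
    - exists (Rmax a (x - d / 2)).
      unfold Rmax; destruct Rle_dec; rewrite Rabs_left; lra. }
  destruct Hy as (y & Dy & Hyx & Hy).
  pose proof (Rmin_l d1 d2). pose proof (Rmin_r d1 d2).
  specialize (B1 y Dy ltac:(lra)). specialize (B2 y Dy ltac:(lra)).
  assert (0 < Rabs (y - x)) by (apply Rabs_pos_lt; lra).
  assert (Rabs ((y - x) * (l1 - l2)) <= Rabs (l1 - l2) / 2 * Rabs (y - x)).
  { replace ((y - x) * (l1 - l2)) with
      ((g y - g x - (y - x) * l2) - (g y - g x - (y - x) * l1)) by ring.
    eapply Rle_trans; [apply Rabs_triang|]. rewrite Rabs_Ropp. lra. }
  match goal with H : Rabs (_ * _) <= _ |- _ => rewrite Rabs_mult in H end.
  nra.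
Qed.

Lemma Derive_on_eq (a b : R) (g : R -> R) (x l : R) :
  a < b -> Icc a b x -> is_derive_on (Icc a b) g x l ->
  Derive_on (Icc a b) g x = l.
Proof.
  intros Hab Hx Hl.
  apply (iota_unique (V := R_CompleteNormedModule)
           (is_derive_on (Icc a b) g x));
    [|exact Hl].
  intros y Hy. now apply (is_derive_on_unique a b g x).
Qed.

Lemma Derive_on_correct (a b : R) (g : R -> R) (x : R) :
  a < b -> Icc a b x -> ex_derive_on (Icc a b) g x ->
  is_derive_on (Icc a b) g x (Derive_on (Icc a b) g x).
Proof.
  intros Hab Hx [l Hl]. now rewrite (Derive_on_eq a b g x l).
Qed.

(* [MVT_gen] wants two-sided continuity at the end points of the segment;
   composing with the projection onto the segment provides it. *)
Lemma mean_value_bound (D : R -> Prop) (g g' : R -> R) (x y M : R) :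
  (forall z, Rmin x y <= z <= Rmax x y ->
     D z /\ is_derive_on D g z (g' z) /\ Rabs (g' z) <= M) ->
  Rabs (g y - g x) <= M * Rabs (y - x).
Proof.
  intros H.
  pose proof (Rmin_l x y). pose proof (Rmin_r x y).
  pose proof (Rmax_l x y). pose proof (Rmax_r x y).
  set (p := Rmin x y) in *. set (q := Rmax x y) in *.
  set (proj z := Rmax p (Rmin z q)).
  assert (Hproj : forall z, p <= proj z <= q).
  { intros z. unfold proj, Rmax, Rmin; repeat destruct Rle_dec; lra. }
  assert (Hid : forall z, p <= z <= q -> proj z = z).
  { intros z Hz. unfold proj, Rmax, Rmin; repeat destruct Rle_dec; lra. }
  assert (Hlip : forall z z', p <= z <= q ->
    Rabs (proj z' - z) <= Rabs (z' - z)).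
  { intros z z' Hz. unfold proj, Rmax, Rmin, Rabs;
    repeat destruct Rle_dec; repeat destruct Rcase_abs; lra. }
  destruct (MVT_gen (fun z => g (proj z)) x y g') as (c & Hc & E).
  - fold p q. intros z Hz.
    destruct (H z ltac:(lra)) as (Dz & Hg & _).
    split; [apply is_linear_scal_l|].
    intros z0 Hz0.
    assert (z = z0) as <- by now apply is_filter_lim_locally_unique.
    intros eps.
    destruct (is_derive_on_bound _ _ _ _ Dz Hg eps) as [d Hd].
    (* This radius keeps [s] between [p] and [q], where [proj] is the identity, so the relative
       derivative becomes a two-sided one. *)
    assert (Hm : 0 < Rmin d (Rmin (z - p) (q - z)))
      by (repeat apply Rmin_pos; try lra; apply cond_pos).
    exists (mkposreal _ Hm). intros s Hs.
    change (Rabs (s - z) < Rmin d (Rmin (z - p) (q - z))) in Hs.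
    pose proof (Rmin_l d (Rmin (z - p) (q - z))).
    pose proof (Rmin_r d (Rmin (z - p) (q - z))).
    pose proof (Rmin_l (z - p) (q - z)). pose proof (Rmin_r (z - p) (q - z)).
    assert (Hs' : p <= s <= q).
    { assert (Hs2 : Rabs (s - z) < Rmin (z - p) (q - z)) by lra.
      apply Rabs_def2 in Hs2. lra. }
    rewrite (Hid s Hs'), (Hid z ltac:(lra)).
    exact (Hd s (proj1 (H s Hs')) ltac:(lra)).
  - fold p q. intros z Hz.
    destruct (H z Hz) as (Dz & Hg & _).
    destruct (is_derive_on_bound _ _ _ _ Dz Hg (mkposreal 1 Rlt_0_1))
      as [d Hd].
    simpl in Hd.
    intros eps Heps.
    pose proof (Rabs_pos (g' z)) as Hg'.
    (* [Hd], taken with tolerance 1, lets [g] vary by at most [(1 + Rabs (g' z)) * Rabs r] near [z],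
       and [proj] moves no point farther from [z]. *)
    assert (He : 0 < eps / (2 + Rabs (g' z)))
      by (apply Rdiv_lt_0_compat; lra).
    exists (Rmin d (eps / (2 + Rabs (g' z)))).
    split; [apply Rmin_pos; [apply cond_pos|exact He]|].
    intros s [_ Hs]. unfold dist in *; simpl in *. unfold Rdist in *.
    pose proof (Rmin_l d (eps / (2 + Rabs (g' z)))).
    pose proof (Rmin_r d (eps / (2 + Rabs (g' z)))).
    pose proof (Hlip z s Hz) as Hl.
    rewrite (Hid z Hz).
    specialize (Hd (proj s) (proj1 (H _ (Hproj s))) ltac:(lra)).
    set (r := proj s - z) in *.
    assert (Hr : Rabs r < eps / (2 + Rabs (g' z))) by lra.
    apply (Rmult_lt_compat_r (2 + Rabs (g' z))) in Hr; [|lra].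
    replace (eps / (2 + Rabs (g' z)) * (2 + Rabs (g' z))) with eps in Hr
      by (field; lra).
    replace (g (proj s) - g z) with ((g (proj s) - g z - r * g' z) + r * g' z)
      by ring.
    eapply Rle_lt_trans; [apply Rabs_triang|].
    rewrite Rabs_mult. pose proof (Rabs_pos r). nra.
  - fold p q in Hc.
    rewrite (Hid x), (Hid y) in E by lra.
    rewrite E, Rabs_mult.
    apply Rmult_le_compat_r; [apply Rabs_pos|].
    apply (H c Hc).
Qed.

(** Induction on [n] for all [G]: the remainder has as derivative the remainder of the shifted
    sequence, one degree lower, and the mean value bound gains a factor [Rabs (y - x)]. Only the
    order matters, so no factorial is kept. With [D] and [G] free, one-sided time derivatives and
    ordinary space derivatives are both covered. *)
Lemma taylor_bound (D : R -> Prop) (G : nat -> R -> R) (n : nat) (x y M : R) :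
  0 <= M ->
  (forall z, Rmin x y <= z <= Rmax x y ->
     D z /\ (forall k, (k <= n)%nat -> is_derive_on D (G k) z (G (S k) z)) /\
     Rabs (G (S n) z) <= M) ->
  Rabs (G O y - sum_f_R0 (fun k => G k x / INR (fact k) * (y - x) ^ k) n)
    <= M * Rabs (y - x) ^ S n.
Proof.
  intros HM. revert G y. induction n as [|n IH]; intros G y H.
  - simpl. replace (G O y - G O x / 1 * 1) with (G O y - G O x) by field.
    rewrite Rmult_1_r.
    apply (mean_value_bound D (G O) (G 1%nat)).
    intros z Hz. destruct (H z Hz) as (Dz & Hd & Hb). auto.
  (* [S_] is the Taylor polynomial of [G] at [x], and [T_] that of the shifted sequence. *)
  - set (S_ m z := sum_f_R0 (fun k => G k x / INR (fact k) * (z - x) ^ k) m).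
    set (T_ m z :=
      sum_f_R0 (fun k => G (S k) x / INR (fact k) * (z - x) ^ k) m).
    assert (HS : forall m z, is_derive (S_ (S m)) z (T_ m z)).
    { intros m z. induction m as [|m IHm].
      - unfold S_, T_; simpl. auto_derive; [exact I|]. field.
      - assert (E1 : forall t, S_ (S (S m)) t = S_ (S m) t +
          G (S (S m)) x / INR (fact (S (S m))) * (t - x) ^ S (S m))
          by reflexivity.
        apply is_derive_ext with (1 := fun t => eq_sym (E1 t)).
        replace (T_ (S m) z) with (T_ m z +
          G (S (S m)) x / INR (fact (S m)) * (z - x) ^ S m) by reflexivity.
        apply (is_derive_plus (S_ (S m))); [exact IHm|].
        assert (Hpow : forall c k, is_derive (fun t => c * (t - x) ^ S k) z
                  (c * (INR (S k) * (z - x) ^ k))).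
        { intros c k. auto_derive; [exact I|].
          change (c * (1 * (INR (S k) * (z - x) ^ k)) =
                  c * (INR (S k) * (z - x) ^ k)).
          ring. }
        replace (G (S (S m)) x / INR (fact (S m)) * (z - x) ^ S m)
          with (G (S (S m)) x / INR (fact (S (S m))) *
                (INR (S (S m)) * (z - x) ^ S m)); [apply Hpow|].
        rewrite (fact_simpl (S m)), mult_INR.
        field. split; [apply INR_fact_neq_0|now apply not_0_INR]. }
    assert (H0 : S_ (S n) x = G O x).
    { unfold S_. clear. induction n as [|n IHn].
      - simpl. field.
      - rewrite tech5, IHn. replace (x - x) with 0 by ring.
        rewrite pow_i by lia. ring. }
    change (Rabs (G O y - S_ (S n) y) <= M * Rabs (y - x) ^ S (S n)).
    (* The added term is the remainder at [x], zero by [H0]; it gives the form required by the mean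
       value bound. *)
    replace (G O y - S_ (S n) y)
      with ((G O y - S_ (S n) y) - (G O x - S_ (S n) x)) by lra.
    replace (M * Rabs (y - x) ^ S (S n))
      with (M * Rabs (y - x) ^ S n * Rabs (y - x)) by (simpl; ring).
    apply (mean_value_bound D (fun z => G O z - S_ (S n) z)
             (fun z => G 1%nat z - T_ n z)).
    intros z Hz. destruct (H z Hz) as (Dz & Hd & Hb).
    split; [exact Dz|split].
    + apply is_derive_on_minus; [apply Hd; lia|].
      apply is_derive_on_of_is_derive; [exact Dz|apply HS].
    + eapply Rle_trans.
      * apply (IH (fun k => G (S k)) z).
        intros s Hs.
        assert (Hs' : Rmin x y <= s <= Rmax x y).
        { revert Hs Hz. unfold Rmin, Rmax; repeat destruct Rle_dec; lra. }
        destruct (H s Hs') as (Ds & Hds & Hbs).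
        split; [exact Ds|split; [|exact Hbs]].
        intros k Hk. apply Hds. lia.
      * apply Rmult_le_compat_l; [exact HM|].
        apply pow_incr. split; [apply Rabs_pos|].
        revert Hz. unfold Rmin, Rmax, Rabs;
          repeat destruct Rle_dec; repeat destruct Rcase_abs; lra.
Qed.

(** * Expansions modulo O(h^4) *)

Lemma at_right_0_lt (d : R) : 0 < d -> at_right 0 (fun h => 0 < h < d).
Proof.
  intros Hd. exists (mkposreal d Hd). intros h Hh Hpos.
  change (Rabs (h - 0) < d) in Hh. apply Rabs_def2 in Hh. lra.
Qed.

Lemma bigO_ext (g1 g2 : R -> R) (p : nat) :
  at_right 0 (fun h => g1 h = g2 h) -> is_bigO_pow g1 p -> is_bigO_pow g2 p.
Proof.
  intros E [C H]. exists C.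
  generalize (filter_and _ _ E H). apply filter_imp.
  intros h [-> ?]. assumption.
Qed.

Lemma bigO_ext_all (g1 g2 : R -> R) (p : nat) :
  (forall h, g1 h = g2 h) -> is_bigO_pow g1 p -> is_bigO_pow g2 p.
Proof. intros E. apply bigO_ext, filter_forall, E. Qed.

Lemma bigO_le (g : R -> R) (p q : nat) :
  (q <= p)%nat -> is_bigO_pow g p -> is_bigO_pow g q.
Proof.
  intros Hpq [C H]. exists (Rabs C).
  generalize (filter_and _ _ (at_right_0_lt 1 Rlt_0_1) H). apply filter_imp.
  intros h [Hh Hg]. eapply Rle_trans; [exact Hg|].
  replace p with ((p - q) + q)%nat by lia. rewrite pow_add.
  assert (0 < h ^ q) by (apply pow_lt; lra).
  assert (0 < h ^ (p - q)) by (apply pow_lt; lra).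
  assert (h ^ (p - q) <= 1).
  { rewrite <- (pow1 (p - q)). apply pow_incr. lra. }
  pose proof (Rle_abs C). pose proof (Rabs_pos C).
  apply Rle_trans with (Rabs C * (h ^ (p - q) * h ^ q)).
  - apply Rmult_le_compat_r; nra.
  - apply Rmult_le_compat_l; nra.
Qed.

Lemma bigO_const (c : R) : is_bigO_pow (fun _ => c) 0.
Proof. exists (Rabs c). apply filter_forall. intros h. simpl. lra. Qed.

Lemma bigO_pow (p : nat) : is_bigO_pow (fun h => h ^ p) p.
Proof.
  exists 1. generalize (at_right_0_lt 1 Rlt_0_1). apply filter_imp.
  intros h Hh. rewrite Rabs_right; [lra|]. apply Rle_ge, pow_le. lra.
Qed.

Lemma bigO_plus (g1 g2 : R -> R) (p : nat) :
  is_bigO_pow g1 p -> is_bigO_pow g2 p ->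
  is_bigO_pow (fun h => g1 h + g2 h) p.
Proof.
  intros [C1 H1] [C2 H2]. exists (C1 + C2).
  generalize (filter_and _ _ H1 H2). apply filter_imp.
  intros h [? ?]. eapply Rle_trans; [apply Rabs_triang|]. lra.
Qed.

Lemma bigO_mult (g1 g2 : R -> R) (p q : nat) :
  is_bigO_pow g1 p -> is_bigO_pow g2 q ->
  is_bigO_pow (fun h => g1 h * g2 h) (p + q).
Proof.
  intros [C1 H1] [C2 H2]. exists (C1 * C2).
  generalize (filter_and _ _ H1 H2). apply filter_imp.
  intros h [? ?]. rewrite Rabs_mult, pow_add.
  replace (C1 * C2 * (h ^ p * h ^ q)) with ((C1 * h ^ p) * (C2 * h ^ q))
    by ring.
  apply Rmult_le_compat; auto using Rabs_pos.
Qed.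

Lemma bigO_scal (c : R) (g : R -> R) (p : nat) :
  is_bigO_pow g p -> is_bigO_pow (fun h => c * g h) p.
Proof. exact (bigO_mult _ g 0 p (bigO_const c)). Qed.

Lemma bigO_minus (g1 g2 : R -> R) (p : nat) :
  is_bigO_pow g1 p -> is_bigO_pow g2 p ->
  is_bigO_pow (fun h => g1 h - g2 h) p.
Proof.
  intros H1 H2.
  apply bigO_ext_all with (fun h => g1 h + (-1) * g2 h); [intros h; ring|].
  apply bigO_plus; [exact H1|now apply bigO_scal].
Qed.

Lemma bigO_pow_n (g : R -> R) (p : nat) :
  is_bigO_pow g 1 -> is_bigO_pow (fun h => g h ^ p) p.
Proof.
  intros H. induction p as [|p IH].
  - exact (bigO_const 1).
  - exact (bigO_mult g _ 1 p H IH).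
Qed.

Lemma bigO_cancel_h (g : R -> R) (p : nat) :
  is_bigO_pow (fun h => h * g h) (S p) -> is_bigO_pow g p.
Proof.
  intros [C H]. exists C.
  generalize (filter_and _ _ (at_right_0_lt 1 Rlt_0_1) H). apply filter_imp.
  intros h [Hh Hg]. rewrite Rabs_mult, (Rabs_right h) in Hg by lra.
  simpl in Hg. apply (Rmult_le_reg_l h); lra.
Qed.

(** A nonzero constant is not O(h), so the leading coefficient must vanish, after which a factor [h]
    cancels. This peels off the coefficients of an expansion one at a time. *)
Lemma bigO_head (c : R) (q : R -> R) (p : nat) :
  is_bigO_pow q 0 -> is_bigO_pow (fun h => c + h * q h) (S p) ->
  c = 0 /\ is_bigO_pow q p.
Proof.
  intros Hq Hc.
  assert (Hc0 : c = 0).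
  { destruct (Req_dec c 0) as [E | Hne]; [exact E|exfalso].
    assert (H1 : is_bigO_pow (fun _ => c) 1).
    { apply bigO_ext_all with (fun h => (c + h * q h) - h ^ 1 * q h);
        [intros h; ring|].
      apply bigO_minus; [now apply (bigO_le _ (S p)); [lia|]|].
      exact (bigO_mult _ _ 1 0 (bigO_pow 1) Hq). }
    destruct H1 as [C HC].
    (* Below this value of [h], [Rabs C * h] is smaller than [Rabs c], against [HC]. *)
    assert (Hd : 0 < Rabs c / (1 + Rabs C)).
    { apply Rdiv_lt_0_compat; [now apply Rabs_pos_lt|].
      pose proof (Rabs_pos C). lra. }
    destruct (filter_ex _ (filter_and _ _ HC (at_right_0_lt _ Hd)))
      as (h & H1 & H2).
    pose proof (Rabs_pos C). pose proof (Rle_abs C).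
    destruct H2 as [H2 H3].
    apply (Rmult_lt_compat_r (1 + Rabs C)) in H3; [|lra].
    replace (Rabs c / (1 + Rabs C) * (1 + Rabs C)) with (Rabs c) in H3
      by (field; lra).
    simpl in H1. nra. }
  split; [exact Hc0|].
  apply bigO_cancel_h. apply bigO_ext_all with (2 := Hc).
  intros h. rewrite Hc0. ring.
Qed.

(** * Cubic expansions at 0+ and their algebra *)

Definition poly3 (c0 c1 c2 c3 h : R) : R := c0 + h * (c1 + h * (c2 + h * c3)).

Definition jet (g : R -> R) (c0 c1 c2 c3 : R) : Prop :=
  is_bigO_pow (fun h => g h - poly3 c0 c1 c2 c3 h) 4.

Lemma bigO_affine (c : R) (g : R -> R) :
  is_bigO_pow g 0 -> is_bigO_pow (fun h => c + h * g h) 0.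
Proof.
  intros Hg. apply bigO_plus; [apply bigO_const|].
  apply (bigO_mult (fun h => h) g 0 0); [|exact Hg].
  apply bigO_ext_all with (fun h => h ^ 1); [intros h; ring|].
  apply (bigO_le _ 1); [lia|apply bigO_pow].
Qed.

(** The Horner form of [poly3] lets [bigO_head] apply four times. The forward direction is what
    refutes fourth order in the exceptional case of B1. *)
Lemma jet_bigO_4_iff (g : R -> R) (c0 c1 c2 c3 : R) :
  jet g c0 c1 c2 c3 ->
  is_bigO_pow g 4 <-> c0 = 0 /\ c1 = 0 /\ c2 = 0 /\ c3 = 0.
Proof.
  intros Hj. split.
  - intros Hg.
    assert (H : is_bigO_pow (poly3 c0 c1 c2 c3) 4).
    { apply bigO_ext_all with (fun h => g h - (g h - poly3 c0 c1 c2 c3 h));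
        [intros h; ring|].
      now apply bigO_minus. }
    unfold poly3 in H.
    apply bigO_head in H; [|repeat apply bigO_affine; apply bigO_const].
    destruct H as [E0 H].
    apply bigO_head in H; [|repeat apply bigO_affine; apply bigO_const].
    destruct H as [E1 H].
    apply bigO_head in H; [|repeat apply bigO_affine; apply bigO_const].
    destruct H as [E2 H].
    assert (E3 : c3 = 0).
    { apply (bigO_head c3 (fun _ => 0) 0 (bigO_const 0)).
      apply bigO_ext_all with (2 := H). intros h. ring. }
    auto.
  - intros (-> & -> & -> & ->). unfold jet in Hj.
    apply bigO_ext_all with (2 := Hj). intros h. unfold poly3. ring.
Qed.

Lemma jet_bigO_3 (g : R -> R) (c3 : R) : jet g 0 0 0 c3 -> is_bigO_pow g 3.
Proof.
  intros Hj.
  apply bigO_ext_all with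
    (fun h => (g h - poly3 0 0 0 c3 h) + c3 * h ^ 3);
    [intros h; unfold poly3; ring|].
  apply bigO_plus; [now apply (bigO_le _ 4); [lia|]|].
  apply bigO_scal, bigO_pow.
Qed.

Lemma jet_bigO_1 (g : R -> R) (c1 c2 c3 : R) :
  jet g 0 c1 c2 c3 -> is_bigO_pow g 1.
Proof.
  intros Hj.
  apply bigO_ext_all with
    (fun h => (g h - poly3 0 c1 c2 c3 h) + h ^ 1 * (c1 + h * (c2 + h * c3)));
    [intros h; unfold poly3; ring|].
  apply bigO_plus; [now apply (bigO_le _ 4); [lia|]|].
  apply (bigO_mult _ _ 1 0 (bigO_pow 1)).
  repeat apply bigO_affine; apply bigO_const.
Qed.

Lemma jet_bigO_0 (g : R -> R) (c0 c1 c2 c3 : R) :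
  jet g c0 c1 c2 c3 -> is_bigO_pow g 0.
Proof.
  intros Hj.
  apply bigO_ext_all with
    (fun h => (g h - poly3 c0 c1 c2 c3 h) + poly3 c0 c1 c2 c3 h);
    [intros h; ring|].
  apply bigO_plus; [now apply (bigO_le _ 4); [lia|]|].
  unfold poly3. repeat apply bigO_affine; apply bigO_const.
Qed.

Lemma jet_ext (g1 g2 : R -> R) (c0 c1 c2 c3 : R) :
  (forall h, g1 h = g2 h) -> jet g1 c0 c1 c2 c3 -> jet g2 c0 c1 c2 c3.
Proof.
  intros E. apply bigO_ext_all. intros h. now rewrite E.
Qed.

Lemma jet_eq (g : R -> R) (c0 c1 c2 c3 d0 d1 d2 d3 : R) :
  jet g c0 c1 c2 c3 -> c0 = d0 -> c1 = d1 -> c2 = d2 -> c3 = d3 ->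
  jet g d0 d1 d2 d3.
Proof. now intros H -> -> -> ->. Qed.

Lemma jet_near (g1 g2 : R -> R) (c0 c1 c2 c3 : R) :
  is_bigO_pow (fun h => g2 h - g1 h) 4 ->
  jet g1 c0 c1 c2 c3 -> jet g2 c0 c1 c2 c3.
Proof.
  intros H H1. unfold jet.
  apply bigO_ext_all with
    (fun h => (g2 h - g1 h) + (g1 h - poly3 c0 c1 c2 c3 h)); [intros h; ring|].
  now apply bigO_plus.
Qed.

Lemma jet_poly3 (c0 c1 c2 c3 : R) : jet (poly3 c0 c1 c2 c3) c0 c1 c2 c3.
Proof.
  apply bigO_ext_all with (fun h => 0 * h ^ 4); [intros h; ring|].
  apply bigO_scal, bigO_pow.
Qed.

Lemma jet_const (c : R) : jet (fun _ => c) c 0 0 0.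
Proof.
  apply jet_ext with (2 := jet_poly3 c 0 0 0). intros h. unfold poly3. ring.
Qed.

Lemma jet_id : jet (fun h => h) 0 1 0 0.
Proof.
  apply jet_ext with (2 := jet_poly3 0 1 0 0). intros h. unfold poly3. ring.
Qed.

Lemma jet_plus (g1 g2 : R -> R) (c0 c1 c2 c3 d0 d1 d2 d3 : R) :
  jet g1 c0 c1 c2 c3 -> jet g2 d0 d1 d2 d3 ->
  jet (fun h => g1 h + g2 h) (c0 + d0) (c1 + d1) (c2 + d2) (c3 + d3).
Proof.
  intros H1 H2. unfold jet.
  apply bigO_ext_all with (fun h => (g1 h - poly3 c0 c1 c2 c3 h)
    + (g2 h - poly3 d0 d1 d2 d3 h)); [intros h; unfold poly3; ring|].
  now apply bigO_plus.
Qed.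

Lemma jet_minus (g1 g2 : R -> R) (c0 c1 c2 c3 d0 d1 d2 d3 : R) :
  jet g1 c0 c1 c2 c3 -> jet g2 d0 d1 d2 d3 ->
  jet (fun h => g1 h - g2 h) (c0 - d0) (c1 - d1) (c2 - d2) (c3 - d3).
Proof.
  intros H1 H2. unfold jet.
  apply bigO_ext_all with (fun h => (g1 h - poly3 c0 c1 c2 c3 h)
    - (g2 h - poly3 d0 d1 d2 d3 h)); [intros h; unfold poly3; ring|].
  now apply bigO_minus.
Qed.

(** With cubic parts p1, p2, write g1 g2 - p1 p2 = (g1 - p1) g2 + p1 (g2 - p2); the terms of degree
    4 to 6 in p1 p2 join the remainder. *)
Lemma jet_mult (g1 g2 : R -> R) (c0 c1 c2 c3 d0 d1 d2 d3 : R) :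
  jet g1 c0 c1 c2 c3 -> jet g2 d0 d1 d2 d3 ->
  jet (fun h => g1 h * g2 h) (c0 * d0) (c0 * d1 + c1 * d0)
    (c0 * d2 + c1 * d1 + c2 * d0) (c0 * d3 + c1 * d2 + c2 * d1 + c3 * d0).
Proof.
  intros H1 H2.
  apply bigO_ext_all with (fun h =>
    (g1 h - poly3 c0 c1 c2 c3 h) * g2 h
    + poly3 c0 c1 c2 c3 h * (g2 h - poly3 d0 d1 d2 d3 h)
    + h ^ 4 * ((c1 * d3 + c2 * d2 + c3 * d1)
               + h * ((c2 * d3 + c3 * d2) + h * (c3 * d3))));
    [intros h; unfold poly3; ring|].
  repeat apply bigO_plus.
  - exact (bigO_mult _ _ 4 0 H1 (jet_bigO_0 _ _ _ _ _ H2)).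
  - refine (bigO_mult _ _ 0 4 _ H2).
    exact (jet_bigO_0 _ _ _ _ _ (jet_poly3 c0 c1 c2 c3)).
  - apply (bigO_mult _ _ 4 0 (bigO_pow 4)).
    repeat apply bigO_affine; apply bigO_const.
Qed.

Lemma jet_unique (g : R -> R) (c0 c1 c2 c3 d0 d1 d2 d3 : R) :
  jet g c0 c1 c2 c3 -> jet g d0 d1 d2 d3 ->
  c0 = d0 /\ c1 = d1 /\ c2 = d2 /\ c3 = d3.
Proof.
  intros H1 H2.
  destruct (proj1 (jet_bigO_4_iff _ _ _ _ _
                     (jet_minus _ _ _ _ _ _ _ _ _ _ H1 H2)))
    as (? & ? & ? & ?).
  - apply bigO_ext_all with (fun h => 0 * h ^ 4); [intros h; ring|].
    apply bigO_scal, bigO_pow.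
  - lra.
Qed.

(** * Composition with a smooth function on a strip *)

Lemma bigO_dominated (g1 g2 : R -> R) (M : R) (p : nat) :
  at_right 0 (fun h => Rabs (g1 h) <= M * Rabs (g2 h)) ->
  is_bigO_pow g2 p -> is_bigO_pow g1 p.
Proof.
  intros H1 [C H2]. exists (Rabs M * C).
  generalize (filter_and _ _ H1 H2). apply filter_imp.
  intros h [? ?]. pose proof (Rabs_pos M). pose proof (Rle_abs M).
  pose proof (Rabs_pos (g2 h)).
  apply Rle_trans with (Rabs M * Rabs (g2 h)); [nra|].
  rewrite Rmult_assoc. now apply Rmult_le_compat_l.
Qed.

Lemma bigO_1_small (w : R -> R) (d : R) :
  0 < d -> is_bigO_pow w 1 -> at_right 0 (fun h => Rabs (w h) < d).
Proof.
  intros Hd [C H].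
  assert (He : 0 < d / (1 + Rabs C)).
  { apply Rdiv_lt_0_compat; [exact Hd|]. pose proof (Rabs_pos C). lra. }
  generalize (filter_and _ _ H (at_right_0_lt _ He)). apply filter_imp.
  intros h [Hw [H0 H1]]. pose proof (Rabs_pos C). pose proof (Rle_abs C).
  apply (Rmult_lt_compat_r (1 + Rabs C)) in H1; [|lra].
  replace (d / (1 + Rabs C) * (1 + Rabs C)) with d in H1 by (field; lra).
  simpl in Hw. nra.
Qed.

Lemma bigO_linear (c : R) : is_bigO_pow (fun h => c * h) 1.
Proof.
  apply bigO_ext_all with (fun h => c * h ^ 1); [intros h; ring|].
  apply bigO_scal, bigO_pow.
Qed.

Fixpoint Dt_n (a b : R) (k : nat) (g : R -> R -> R) : R -> R -> R :=
  match k with O => g | S m => Dt a b (Dt_n a b m g) end.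

Fixpoint Du_n (k : nat) (g : R -> R -> R) : R -> R -> R :=
  match k with O => g | S m => Du (Du_n m g) end.

Lemma smooth_strip_Dt (a b : R) (g : R -> R -> R) :
  smooth_strip a b g -> smooth_strip a b (Dt a b g).
Proof. intros H k. apply (H (S k)). Qed.

Lemma smooth_strip_Du (a b : R) (g : R -> R -> R) :
  smooth_strip a b g -> smooth_strip a b (Du g).
Proof. intros H k. apply (H (S k)). Qed.

Lemma smooth_strip_Dt_n (a b : R) (k : nat) (g : R -> R -> R) :
  smooth_strip a b g -> smooth_strip a b (Dt_n a b k g).
Proof. intros H. induction k; simpl; auto using smooth_strip_Dt. Qed.

Lemma smooth_strip_Du_n (a b : R) (k : nat) (g : R -> R -> R) :
  smooth_strip a b g -> smooth_strip a b (Du_n k g).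
Proof. intros H. induction k; simpl; auto using smooth_strip_Du. Qed.

(** Joint continuity gives one bound for all points near [(t, v)]; it serves as the constant [M] of
    [taylor_bound] while the second argument moves with [h]. *)
Lemma smooth_strip_locally_bounded (a b : R) (g : R -> R -> R) (t v : R) :
  smooth_strip a b g -> Icc a b t ->
  exists d M, 0 < d /\ 0 <= M /\ forall s y, Icc a b s ->
    Rabs (s - t) < d -> Rabs (y - v) < d -> Rabs (g s y) <= M.
Proof.
  intros Hg Ht. destruct (Hg O) as [Hc _].
  destruct (Hc (t, v) Ht _ (locally_ball (g t v) (mkposreal 1 Rlt_0_1)))
    as [d Hd].
  exists d, (Rabs (g t v) + 1).
  split; [apply cond_pos|]. split; [pose proof (Rabs_pos (g t v)); lra|].
  intros s y Hs Hst Hyv.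
  specialize (Hd (s, y) (conj Hst Hyv) Hs).
  change (Rabs (g s y - g t v) < 1) in Hd.
  pose proof (Rabs_triang_inv (g s y) (g t v)). lra.
Qed.

(** The second argument stays at [v + w h], so the coefficients still depend on [h]; they are
    expanded afterwards in the space variable. *)
Lemma taylor_bigO_time (a b t v : R) (w : R -> R) (g : R -> R -> R) (c : R)
    (n : nat) :
  a <= t < b -> is_bigO_pow w 1 -> 0 <= c -> smooth_strip a b g ->
  is_bigO_pow (fun h => g (t + c * h) (v + w h) -
    sum_f_R0 (fun k =>
      Dt_n a b k g t (v + w h) / INR (fact k) * (c * h) ^ k) n) (S n).
Proof.
  intros Ht Hw Hc Hg.
  assert (HtI : Icc a b t) by (unfold Icc; lra).
  destruct (smooth_strip_locally_bounded a b _ t v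
              (smooth_strip_Dt_n a b (S n) g Hg) HtI)
    as (d & M & Hd & HM & Hb).
  apply bigO_dominated with (fun h => (c * h) ^ S n) M;
    [|apply bigO_pow_n, bigO_linear].
  assert (Hbt : 0 < b - t) by lra.
  (* The bounds by [d] keep the arguments where [M] applies; the bound by [b - t] keeps the time in
     [[a, b]]. *)
  generalize (filter_and _ _ (bigO_1_small w d Hd Hw)
    (filter_and _ _ (bigO_1_small _ d Hd (bigO_linear c))
      (filter_and _ _ (bigO_1_small _ _ Hbt (bigO_linear c))
         (at_right_0_lt 1 Rlt_0_1)))).
  apply filter_imp. intros h (Hwh & Hch & Hchb & Hh).
  assert (0 <= c * h) by (apply Rmult_le_pos; lra).
  rewrite Rabs_right in Hch, Hchb by lra.
  rewrite <- RPow_abs.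
  pose proof (taylor_bound (Icc a b) (fun k s => Dt_n a b k g s (v + w h))
    n t (t + c * h) M HM) as HT.
  cbv beta in HT. replace (t + c * h - t) with (c * h) in HT by ring.
  apply HT. rewrite Rmin_left, Rmax_right by lra.
  intros z Hz. assert (HzI : Icc a b z) by (unfold Icc; lra).
  split; [exact HzI|]. split.
  - intros k _.
    apply (Derive_on_correct a b (fun s => Dt_n a b k g s (v + w h)));
      [lra|exact HzI|].
    apply (smooth_strip_Dt_n a b k g Hg 1%nat). exact HzI.
  - apply Hb; [exact HzI| |].
    + rewrite Rabs_right; lra.
    + replace (v + w h - v) with (w h) by ring. exact Hwh.
Qed.

Lemma taylor_bigO_space (a b t v : R) (w : R -> R) (g : R -> R -> R)
    (n : nat) :
  Icc a b t -> is_bigO_pow w 1 -> smooth_strip a b g ->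
  is_bigO_pow (fun h => g t (v + w h) -
    sum_f_R0 (fun k => Du_n k g t v / INR (fact k) * w h ^ k) n) (S n).
Proof.
  intros HtI Hw Hg.
  destruct (smooth_strip_locally_bounded a b _ t v
              (smooth_strip_Du_n a b (S n) g Hg) HtI)
    as (d & M & Hd & HM & Hb).
  apply bigO_dominated with (fun h => w h ^ S n) M; [|now apply bigO_pow_n].
  generalize (bigO_1_small w d Hd Hw). apply filter_imp. intros h Hwh.
  rewrite <- RPow_abs.
  pose proof (taylor_bound (fun _ => True) (fun k y => Du_n k g t y)
    n v (v + w h) M HM) as HT.
  cbv beta in HT. replace (v + w h - v) with (w h) in HT by ring.
  apply HT.
  intros z Hz. split; [exact I|]. split.
  - intros k _. apply is_derive_on_of_is_derive; [exact I|].
    apply Derive_correct.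
    apply (smooth_strip_Du_n a b k g Hg 1%nat). exact HtI.
  - apply Hb; [exact HtI| |].
    + rewrite Rminus_diag, Rabs_R0. exact Hd.
    + revert Hz Hwh. unfold Rmin, Rmax, Rabs;
        repeat destruct Rle_dec; repeat destruct Rcase_abs; lra.
Qed.

(* [chain1], [chain2], [chain3] are the coefficients of h, h^2, h^3 in
   f (t + c h) (v + q1 h + q2 h^2 + q3 h^3). *)
Definition chain1 (a b : R) (f : R -> R -> R) (t v c q1 : R) : R :=
  Dt a b f t v * c + Du f t v * q1.

Definition chain2 (a b : R) (f : R -> R -> R) (t v c q1 q2 : R) : R :=
  Du f t v * q2 + (Dt a b (Dt a b f) t v * c ^ 2
    + 2 * Du (Dt a b f) t v * c * q1 + Du (Du f) t v * q1 ^ 2) / 2.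

Definition chain3 (a b : R) (f : R -> R -> R) (t v c q1 q2 q3 : R) : R :=
  Du f t v * q3 + Du (Dt a b f) t v * c * q2 + Du (Du f) t v * q1 * q2
  + (Dt a b (Dt a b (Dt a b f)) t v * c ^ 3
     + 3 * Du (Dt a b (Dt a b f)) t v * c ^ 2 * q1
     + 3 * Du (Du (Dt a b f)) t v * c * q1 ^ 2
     + Du (Du (Du f)) t v * q1 ^ 3) / 6.

(** The coefficients are left as existential variables filled in by the sum and product rules;
    [jet_eq] then compares them with the intended ones. *)
Ltac jet_ops :=
  repeat first [eassumption | apply jet_const | apply jet_id
    | eapply jet_plus | eapply jet_minus | eapply jet_mult].

(* Expanding in time first and then in space only meets the derivatives
   [Du^j (Dt^k g)], so the symmetry of mixed derivatives is never needed. *)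
Lemma jet_comp (a b t v : R) (w : R -> R) (g : R -> R -> R)
    (c q1 q2 q3 : R) :
  a <= t < b -> 0 <= c -> smooth_strip a b g -> jet w 0 q1 q2 q3 ->
  jet (fun h => g (t + c * h) (v + w h))
    (g t v)
    (chain1 a b g t v c q1)
    (chain2 a b g t v c q1 q2)
    (chain3 a b g t v c q1 q2 q3).
Proof.
  intros Ht Hc Hg Hj.
  assert (HtI : Icc a b t) by (unfold Icc; lra).
  assert (Hw := jet_bigO_1 _ _ _ _ Hj).
  pose (Dtt := Dt a b (Dt a b g)). pose (Dttt := Dt a b Dtt).
  (* This is the Taylor polynomial of total degree 3 in the increments [c * h] and [w h]. *)
  apply jet_near with (fun h =>
    (g t v + Du g t v * w h + Du (Du g) t v / 2 * (w h * w h)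
       + Du (Du (Du g)) t v / 6 * (w h * (w h * w h)))
    + (c * h) * (Dt a b g t v + Du (Dt a b g) t v * w h
                 + Du (Du (Dt a b g)) t v / 2 * (w h * w h))
    + (c * h) * (c * h) * (Dtt t v / 2 + Du Dtt t v / 2 * w h)
    + (c * h) * ((c * h) * (c * h)) * (Dttt t v / 6)).
  - pose proof (taylor_bigO_time a b t v w g c 3 Ht Hw Hc Hg) as T.
    (* The k-th time derivative carries the factor [(c * h) ^ k], so a space expansion to degree 3 -
       k leaves a remainder O(h^4). *)
    pose proof (taylor_bigO_space a b t v w g 3 HtI Hw Hg) as S0.
    pose proof (taylor_bigO_space a b t v w (Dt a b g) 2 HtI Hw
      (smooth_strip_Dt_n a b 1 g Hg)) as S1.
    pose proof (taylor_bigO_space a b t v w Dtt 1 HtI Hw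
      (smooth_strip_Dt_n a b 2 g Hg)) as S2.
    pose proof (taylor_bigO_space a b t v w Dttt 0 HtI Hw
      (smooth_strip_Dt_n a b 3 g Hg)) as S3.
    pose proof (bigO_linear c) as L.
    pose proof (bigO_mult _ _ 1 3 L S1) as P1.
    pose proof (bigO_scal (1/2) _ 4
      (bigO_mult _ _ 2 2 (bigO_pow_n _ 2 L) S2)) as P2.
    pose proof (bigO_scal (1/6) _ 4
      (bigO_mult _ _ 3 1 (bigO_pow_n _ 3 L) S3)) as P3.
    refine (bigO_ext_all _ _ 4 _ (bigO_plus _ _ 4 (bigO_plus _ _ 4
      (bigO_plus _ _ 4 (bigO_plus _ _ 4 T S0) P1) P2) P3)).
    intros h. simpl. fold Dtt Dttt. field.
  - eapply jet_eq; [jet_ops|unfold chain1, chain2, chain3, Dttt, Dtt; field ..].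
Qed.

(** * Expansion of the truncation error *)

Lemma Derive_n_on_locally_bounded (a b : R) (g : R -> R) (n : nat) (t : R) :
  smooth_on (Icc a b) g -> Icc a b t ->
  exists d M, 0 < d /\ 0 <= M /\ forall s, Icc a b s ->
    Rabs (s - t) < d -> Rabs (Derive_n_on (Icc a b) n g s) <= M.
Proof.
  intros Hg Ht. destruct (Hg n t Ht) as [l Hl].
  set (G := Derive_n_on (Icc a b) n g) in *.
  destruct (is_derive_on_bound _ _ _ _ Ht Hl (mkposreal 1 Rlt_0_1)) as [d Hd].
  simpl in Hd.
  exists (Rmin d 1), (Rabs (G t) + (Rabs l + 1)).
  pose proof (Rabs_pos (G t)). pose proof (Rabs_pos l).
  split; [apply Rmin_pos; [apply cond_pos|lra]|]. split; [lra|].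
  intros s Hs Hst.
  pose proof (Rmin_l d 1). pose proof (Rmin_r d 1).
  specialize (Hd s Hs ltac:(lra)).
  replace (G s) with (G t + ((s - t) * l + (G s - G t - (s - t) * l))) by ring.
  eapply Rle_trans; [apply Rabs_triang|]. apply Rplus_le_compat_l.
  eapply Rle_trans; [apply Rabs_triang|]. rewrite Rabs_mult.
  pose proof (Rabs_pos (s - t)). nra.
Qed.

(** The offset [m] allows the expansion of [u] itself as well as that of its derivative. *)
Lemma taylor_bigO_smooth_on (a b : R) (g : R -> R) (t : R) (m n : nat) :
  smooth_on (Icc a b) g -> a <= t < b ->
  is_bigO_pow (fun h => Derive_n_on (Icc a b) m g (t + h) -
    sum_f_R0 (fun k =>
      Derive_n_on (Icc a b) (k + m) g t / INR (fact k) * h ^ k) n) (S n).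
Proof.
  intros Hg Ht. assert (HtI : Icc a b t) by (unfold Icc; lra).
  destruct (Derive_n_on_locally_bounded a b g (S n + m) t Hg HtI)
    as (d & M & Hd & HM & Hb).
  apply bigO_dominated with (fun h => h ^ S n) M; [|apply bigO_pow].
  assert (Hm : 0 < Rmin d (b - t)) by (apply Rmin_pos; lra).
  generalize (at_right_0_lt _ Hm). apply filter_imp. intros h Hh.
  pose proof (Rmin_l d (b - t)). pose proof (Rmin_r d (b - t)).
  rewrite <- RPow_abs.
  pose proof (taylor_bound (Icc a b)
    (fun k => Derive_n_on (Icc a b) (k + m) g) n t (t + h) M HM) as HT.
  cbv beta in HT. replace (t + h - t) with h in HT by ring.
  apply HT. rewrite Rmin_left, Rmax_right by lra.
  intros z Hz. assert (HzI : Icc a b z) by (unfold Icc; lra).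
  split; [exact HzI|]. split.
  - intros k _. apply (Derive_on_correct a b); [lra|exact HzI|].
    now apply Hg.
  - apply Hb; [exact HzI|]. rewrite Rabs_right; lra.
Qed.

(* Matching the expansions of both sides of [u' (t + h) = f (t + h) (u (t + h))]
   gives the higher derivatives of [u] without differentiating [f] along the
   solution. *)
Lemma solution_derivatives (a b : R) (f : R -> R -> R) (u : R -> R) (t : R) :
  smooth_strip a b f -> smooth_on (Icc a b) u -> is_solution a b f u ->
  a <= t < b ->
  let U n := Derive_n_on (Icc a b) n u t in
  U 1%nat = f t (u t) /\
  U 2%nat = chain1 a b f t (u t) 1 (U 1%nat) /\
  U 3%nat = 2 * chain2 a b f t (u t) 1 (U 1%nat) (U 2%nat / 2) /\
  U 4%nat = 6 * chain3 a b f t (u t) 1 (U 1%nat) (U 2%nat / 2) (U 3%nat / 6).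
Proof.
  intros Hf Hu Hs Ht U.
  assert (J0 : jet (fun h => u (t + h) - u t)
                 0 (U 1%nat) (U 2%nat / 2) (U 3%nat / 6)).
  { refine (bigO_ext_all _ _ 4 _ (taylor_bigO_smooth_on a b u t 0 3 Hu Ht)).
    intros h. unfold poly3, U. simpl. field. }
  assert (J1 : jet (fun h => Derive_n_on (Icc a b) 1 u (t + h))
                 (U 1%nat) (U 2%nat) (U 3%nat / 2) (U 4%nat / 6)).
  { refine (bigO_ext_all _ _ 4 _ (taylor_bigO_smooth_on a b u t 1 3 Hu Ht)).
    intros h. unfold poly3, U. simpl. field. }
  pose proof (jet_comp a b t (u t) _ f 1 _ _ _ Ht Rle_0_1 Hf J0) as J2.
  apply jet_near with (g2 := fun h => Derive_n_on (Icc a b) 1 u (t + h)) in J2.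
  - destruct (jet_unique _ _ _ _ _ _ _ _ _ J1 J2) as (E1 & E2 & E3 & E4).
    lra.
  (* The equation is available only while [t + h <= b], so the two functions agree only for small
     positive [h]. *)
  - apply bigO_ext with (fun h => 0 * h ^ 4);
      [|apply bigO_scal, bigO_pow].
    assert (Hbt : 0 < b - t) by lra.
    generalize (at_right_0_lt _ Hbt). apply filter_imp. intros h Hh.
    assert (HI : Icc a b (t + h)) by (unfold Icc; lra).
    simpl. rewrite (Derive_on_eq a b u (t + h) (f (t + h) (u (t + h))));
      [|lra|exact HI|now apply Hs].
    replace (u t + (u (t + h) - u t)) with (u (t + h)) by ring.
    rewrite Rmult_1_l. ring.
Qed.

(** Division by [h] costs one order, so [u] is expanded to degree 4 with remainder O(h^5). *)
Lemma solution_difference_quotient_jet (a b : R) (u : R -> R) (t : R) :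
  smooth_on (Icc a b) u -> a <= t < b ->
  let U n := Derive_n_on (Icc a b) n u t in
  jet (fun h => (u (t + h) - u t) / h)
    (U 1%nat) (U 2%nat / 2) (U 3%nat / 6) (U 4%nat / 24).
Proof.
  intros Hu Ht U. apply bigO_cancel_h.
  refine (bigO_ext _ _ 5 _ (taylor_bigO_smooth_on a b u t 0 4 Hu Ht)).
  generalize (at_right_0_lt 1 Rlt_0_1). apply filter_imp. intros h Hh.
  unfold poly3, U. simpl. field. lra.
Qed.

(** The [p] and [q] are the coefficients of the increments of the second argument in stages 2 and 3,
    exact for stage 2 and modulo O(h^4) for stage 3; [u2], [u3], [u4] are the higher derivatives of
    the solution. The method coefficients stay symbolic so that one expansion serves all six
    cases. *)
Lemma truncation_error_jet (a b : R) (f : R -> R -> R) (u : R -> R) (t : R)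
    (c : rk3_coeffs) (e2 e3 : R) :
  smooth_strip a b f -> smooth_on (Icc a b) u -> is_solution a b f u ->
  a <= t < b -> 0 <= c2 c -> 0 <= c3 c ->
  let v := u t in
  let F := f t v in
  let E2 := e2 * c2 c ^ 2 / 2 in
  let E3 := e3 * c3 c ^ 2 / 2 in
  let p1 := a21 c * F in
  let p2 := E2 * v in
  let p3 := E2 * (a21 c * F) in
  let k1 := chain1 a b f t v (c2 c) p1 in
  let k2 := chain2 a b f t v (c2 c) p1 p2 in
  let k3 := chain3 a b f t v (c2 c) p1 p2 p3 in
  let q1 := (a31 c + a32 c) * F in
  let q2 := a32 c * k1 + E3 * v in
  let q3 := a32 c * k2 + E3 * ((a31 c + a32 c) * F) in
  let u2 := chain1 a b f t v 1 F in
  let u3 := 2 * chain2 a b f t v 1 F (u2 / 2) in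
  let u4 := 6 * chain3 a b f t v 1 F (u2 / 2) (u3 / 6) in
  jet (truncation_error f u t c e2 e3)
    (F - (w1 c + w2 c + w3 c) * F)
    (u2 / 2 - (w2 c * k1 + w3 c * chain1 a b f t v (c3 c) q1))
    (u3 / 6 - (w2 c * k2 + w3 c * chain2 a b f t v (c3 c) q1 q2))
    (u4 / 24 - (w2 c * k3 + w3 c * chain3 a b f t v (c3 c) q1 q2 q3)).
Proof.
  intros Hf Hu Hs Ht Hc2 Hc3 v F E2 E3 p1 p2 p3 k1 k2 k3 q1 q2 q3 u2 u3 u4.
  destruct (solution_derivatives a b f u t Hf Hu Hs Ht) as (D1 & D2 & D3 & D4).
  pose proof (solution_difference_quotient_jet a b u t Hu Ht) as JU.
  cbv beta zeta in JU. cbv beta in D1, D2, D3, D4.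
  assert (JK2 : jet (fun h => stage2 f c e2 t v h) F k1 k2 k3).
  { assert (Jw := jet_poly3 0 p1 p2 p3).
    refine (jet_ext _ _ _ _ _ _ _ (jet_comp a b t v _ f (c2 c)
      _ _ _ Ht Hc2 Hf Jw)).
    intros h. unfold stage2, stage1. f_equal.
    unfold poly3, p1, p2, p3, E2, F. field. }
  assert (JK3 : jet (fun h => stage3 f c e2 e3 t v h) F
    (chain1 a b f t v (c3 c) q1) (chain2 a b f t v (c3 c) q1 q2)
    (chain3 a b f t v (c3 c) q1 q2 q3)).
  (* Unlike in stage 2, this increment is not a polynomial in [h]: it contains K2, of which only the
     expansion [JK2] is known. *)
  { assert (Jw : jet (fun h =>
      h * (a31 c * F + a32 c * stage2 f c e2 t v h) + E3 * (h * h) *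
      (v + h * (a31 c * F + a32 c * stage2 f c e2 t v h))) 0 q1 q2 q3).
    { eapply jet_eq; [jet_ops|unfold q1, q2, q3; ring ..]. }
    refine (jet_ext _ _ _ _ _ _ _ (jet_comp a b t v _ f (c3 c)
      _ _ _ Ht Hc3 Hf Jw)).
    intros h. unfold stage3, stage1. f_equal. fold F.
    unfold E3. field. }
  unfold truncation_error, increment, stage1. fold v F.
  eapply jet_eq.
  - eapply jet_minus; [exact JU|]. jet_ops.
  - rewrite D1. unfold F, v. ring.
  - rewrite D2, D1. unfold u2, F, v. ring.
  - rewrite D3, D2, D1. unfold u3, u2, F, v. ring.
  - rewrite D4, D3, D2, D1. unfold u4, u3, u2, F, v. ring.
Qed.

(** * The six coefficient sets *)

Theorem mainTheorem2 (a b : R) (f : R -> R -> R) (u : R -> R) (ti : R)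
  (hf : smooth_strip a b f)
  (hu : smooth_on (Icc a b) u)
  (hsol : is_solution a b f u)
  (hti : a <= ti < b) :
  let ui := u ti in
  let u2 := Derive_n_on (Icc a b) 2 u ti in
  let F := f ti ui in
  let ft := Dt a b f ti ui in
  let fu := Du f ti ui in
  let ftt := Dt a b (Dt a b f) ti ui in
  let ftu := Du (Dt a b f) ti ui in
  let fuu := Du (Du f) ti ui in
  let fttt := Dt a b (Dt a b (Dt a b f)) ti ui in
  let fttu := Du (Dt a b (Dt a b f)) ti ui in
  let ftuu := Du (Du (Dt a b f)) ti ui in
  let fuuu := Du (Du (Du f)) ti ui in
  let order := has_order f u ti in
  let r33 := sqrt 33 in
  (* B1 *)
  (let c := {| a21 := 1/2; c2 := 1/2; a31 := -1; a32 := 2; c3 := 1;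
               w1 := 1/6; w2 := 2/3; w3 := 1/6 |} in
   let P := fuu * F - fu ^ 2 + ftu in
   let num := P * u2 in
   let den := P * ui + fu * F in
   let proviso := P * (ft + fu * F) <> 0 -> den <> 0 in
   (proviso ->
      (den <> 0 -> order c (num / den) (- (num / den)) 4%nat) /\
      (num = 0 -> den = 0 -> forall e2 : R, order c e2 (- e2) 4%nat)) /\
   (~ proviso ->
      forall e2 : R, order c e2 (- e2) 3%nat /\ ~ order c e2 (- e2) 4%nat))
  /\
  (* B2(a) *)
  (let c := {| a21 := 5/8 + r33/24; c2 := 5/8 + r33/24;
               a31 := - (49/256) + 29 * r33/768;
               a32 := 209/256 - 61 * r33/768;
               c3 := 5/8 - r33/24;
               w1 := 1/8;
               w2 := 7/16 - 3 * r33/176;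
               w3 := 7/16 + 3 * r33/176 |} in
   let num := 12 * fu ^ 2 * u2
              + (3 + r33) * (F ^ 2 * fuu - ftt) * fu
              + 2 * (3 + r33) * (fuu * F + ftu) * ft in
   let den := (2 * (3 + r33) * (F * fuu + ftu) + (15 + r33) * fu ^ 2) * ui
              + 2 * (3 + r33) * fu * F in
   let e2 := num / den in
   den <> 0 -> order c e2 ((- 7 - r33) / 4 * e2) 4%nat)
  /\
  (* B2(b) *)
  (let c := {| a21 := 5/8 - r33/24; c2 := 5/8 - r33/24;
               a31 := - (49/256) - 29 * r33/768;
               a32 := 209/256 + 61 * r33/768;
               c3 := 5/8 + r33/24;
               w1 := 1/8;
               w2 := 7/16 + 3 * r33/176;
               w3 := 7/16 - 3 * r33/176 |} in
   let num := 12 * fu ^ 2 * u2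
              + (3 - r33) * (fuu * F ^ 2 - ftt) * fu
              + 2 * (3 - r33) * (fuu * F + ftu) * ft in
   let den := (2 * (3 - r33) * (F * fuu + ftu) + (15 - r33) * fu ^ 2) * ui
              + 2 * (3 - r33) * fu * F in
   let e2 := num / den in
   den <> 0 -> order c e2 ((- 7 + r33) / 4 * e2) 4%nat)
  /\
  (* B3(a) *)
  (let c := {| a21 := 1; c2 := 1; a31 := 1/4; a32 := 1/4; c3 := 1/2;
               w1 := 1/6; w2 := 1/6; w3 := 2/3 |} in
   let num := fu ^ 2 * u2 - (ftu * F + ftt) * fu + (fuu * F + ftu) * ft in
   let den := (fuu * F + ftu + 2 * fu ^ 2) * ui + fu * F in
   let e2 := num / den in
   den <> 0 -> order c e2 (- e2) 4%nat)
  /\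
  (* B3(b) *)
  (let c := {| a21 := 1/3; c2 := 1/3; a31 := - (5/12); a32 := 5/4; c3 := 5/6;
               w1 := 1/10; w2 := 1/2; w3 := 2/5 |} in
   let num := 3 * fu ^ 2 * u2 + (ftu * F + ftt) * fu - (fuu * F + ftu) * ft in
   let den := (- fuu * F - ftu + 2 * fu ^ 2) * ui - fu * F in
   let e2 := num / den in
   den <> 0 -> order c e2 (- (1/5) * e2) 4%nat)
  /\
  (* B4 *)
  (let c := {| a21 := 1/2; c2 := 1/2; a31 := 0; a32 := 3/4; c3 := 3/4;
               w1 := 2/9; w2 := 1/3; w3 := 4/9 |} in
   let num := 12 * fu ^ 2 * u2 + fttt + fuuu * F ^ 3
              + 3 * (fttu + ftuu * F) * F in
   let den := 3 * (- fuu * F - ftu + 4 * fu ^ 2) * ui - 3 * fu * F in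
   let e2 := num / den in
   den <> 0 -> order c e2 (- (1/3) * e2) 4%nat).
Proof.
  cbv zeta.
  assert (Hu2 : Derive_n_on (Icc a b) 2 u ti
    = Dt a b f ti (u ti) + Du f ti (u ti) * f ti (u ti)).
  { destruct (solution_derivatives a b f u ti hf hu hsol hti) as (D1 & D2 & _).
    rewrite D2, D1. unfold chain1. ring. }
  rewrite Hu2.
  assert (Hr : sqrt 33 * sqrt 33 = 33) by (apply sqrt_sqrt; lra).
  (* These bounds give [c2] and [c3] at least 3/8 in both B2 cases, as the expansion requires
     nonnegative nodes. *)
  assert (Hr0 : 0 <= sqrt 33 <= 6).
  { split; [apply sqrt_pos|].
    replace 6 with (sqrt (6 * 6)) by (apply sqrt_square; lra).
    apply sqrt_le_1; lra. }
  set (r33 := sqrt 33) in *. clearbody r33.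
  pose proof (fun c e2 e3 => truncation_error_jet a b f u ti c e2 e3
    hf hu hsol hti) as J.
  cbv zeta in J. unfold chain1, chain2, chain3 in J.
  unfold has_order.
  set (F := f ti (u ti)) in *. set (ui := u ti) in *.
  set (ft := Dt a b f ti ui) in *. set (fu := Du f ti ui) in *.
  set (ftt := Dt a b (Dt a b f) ti ui) in *.
  set (ftu := Du (Dt a b f) ti ui) in *.
  set (fuu := Du (Du f) ti ui) in *.
  set (fttt := Dt a b (Dt a b (Dt a b f)) ti ui) in *.
  set (fttu := Du (Dt a b (Dt a b f)) ti ui) in *.
  set (ftuu := Du (Du (Dt a b f)) ti ui) in *.
  set (fuuu := Du (Du (Du f)) ti ui) in *.
  (* From here the derivatives of [f] are free real variables, and each order condition is a
     rational identity. *)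
  clearbody F ft fu ftt ftu fuu fttt fttu ftuu fuuu.
  split; [|repeat split].
  - set (P := fuu * F - fu ^ 2 + ftu).
    set (num := P * (ft + fu * F)). set (den := P * ui + fu * F).
    set (c := {| a21 := 1 / 2; c2 := 1 / 2; a31 := -1; a32 := 2; c3 := 1;
                 w1 := 1 / 6; w2 := 2 / 3; w3 := 1 / 6 |}).
    (* With [e2] arbitrary, this one expansion settles both the fourth-order claims and the failure
       of fourth order. *)
    assert (HJ : forall e2, jet (truncation_error f u ti c e2 (- e2))
                   0 0 0 (- (1 / 24) * (num - den * e2))).
    { intros e2. eapply jet_eq; [apply J; unfold c; cbn [c2 c3]; lra|..].
      all: unfold c; cbn [a21 c2 a31 a32 c3 w1 w2 w3].
      all: unfold num, den, P; field. }
    assert (H4 : forall e2,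
      is_bigO_pow (truncation_error f u ti c e2 (- e2)) 4
        <-> num - den * e2 = 0).
    { intros e2. rewrite (jet_bigO_4_iff _ _ _ _ _ (HJ e2)).
      split; [intros (_ & _ & _ & E); lra|].
      intros ->. repeat split; ring. }
    split.
    + intros _. split.
      * intros Hden. apply H4. field. exact Hden.
      * intros Hnum Hden e2. apply H4. rewrite Hnum, Hden. ring.
    (* Order four would mean [num = den * e2]; then [den = 0] forces [num = 0], so the proviso would
       hold after all. *)
    + intros Hno e2. split; [exact (jet_bigO_3 _ _ (HJ e2))|].
      rewrite H4. intros E. apply Hno. intros Hnum Hden.
      apply Hnum. rewrite Hden in E. lra.
  - intros Hden. eapply jet_bigO_4_iff; [apply J; cbn [c2 c3]; lra|].
    cbn [a21 c2 a31 a32 c3 w1 w2 w3].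
    (* After clearing denominators, the identities hold modulo [r33 * r33 = 33]. *)
    repeat split; field_simplify_eq; try exact Hden; ring [Hr].
  - intros Hden. eapply jet_bigO_4_iff; [apply J; cbn [c2 c3]; lra|].
    cbn [a21 c2 a31 a32 c3 w1 w2 w3].
    repeat split; field_simplify_eq; try exact Hden; ring [Hr].
  - intros Hden. eapply jet_bigO_4_iff; [apply J; cbn [c2 c3]; lra|].
    cbn [a21 c2 a31 a32 c3 w1 w2 w3].
    repeat split; field; exact Hden.
  - intros Hden. eapply jet_bigO_4_iff; [apply J; cbn [c2 c3]; lra|].
    cbn [a21 c2 a31 a32 c3 w1 w2 w3].
    repeat split; field; exact Hden.
  - intros Hden. eapply jet_bigO_4_iff; [apply J; cbn [c2 c3]; lra|].
    cbn [a21 c2 a31 a32 c3 w1 w2 w3].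
    repeat split; field; exact Hden.
Qed.
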